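(* For each integer $\ell\ge 11$ there exists $N=N(\ell)$ such that for all integers $n\ge N$, $$\mathrm{ex}_{\mathcal{P}}(n,C_{\ell}) > \frac{3(\ell-1)}{\ell}\,n-\frac{6(\ell+1)}{\ell}.$$ Furthermore, if $s:\mathbb{Z}^+\to\mathbb{Z}^+$ is a function such that for every integer $\ell\ge 3$ there exists $N'=N'(\ell)$ with $$\mathrm{ex}_{\mathcal{P}}(n,C_{\ell})\le \frac{3(s(\ell)-1)}{s(\ell)}\,n\qquad\text{for all } n\ge N',$$ then $s(\ell)=\Omega(\ell^{\log_2 3})$ as $\ell\to\infty$ (that is, there exist $c>0$ and $\ell_0$ such that $s(\ell)\ge c\,\ell^{\log_2 3}$ for all $\ell\ge \ell_0$).
   Context: All graphs are finite and simple. $C_\ell$ denotes the cycle of length $\ell$. For a graph $H$, the planar Turán number $\mathrm{ex}_{\mathcal{P}}(n,H)$ is the maximum number of edges in an $n$-vertex planar graph with no copy of $H$ as a (not necessarily induced) subgraph. *)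

(* Defs.v *)
From mathcomp Require Import all_boot all_order all_algebra.
From mathcomp Require Import all_classical all_reals all_analysis.
Import Order.TTheory GRing.Theory Num.Theory.
Import numFieldNormedType.Exports.

Set Implicit Arguments.
Unset Strict Implicit.
Unset Printing Implicit Defensive.

Local Open Scope classical_set_scope.
Local Open Scope ring_scope.

(* A finite graph on the vertex type V is given by its set of edges
   E : {set {set V}}, each edge being the set of its endpoints. *)

Definition simple_graph (V : finType) (E : {set {set V}}) : bool :=
  [forall e in E, #|e| == 2%N].

(* Meaningful for l >= 3 only: for l = 1, 2 the edge sets degenerate. *)
Definition cycle_graph (l : nat) : {set {set 'I_l}} :=
  [set [set i; ordS i]%SET | i : 'I_l]%SET.

Definition has_copy (W V : finType) (F : {set {set W}}) (E : {set {set V}}) :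
    Prop :=
  exists2 f : W -> V, injective f & forall e, e \in F -> (f @: e)%SET \in E.

(* p places the vertices; g e, restricted to [0, 1], is the Jordan arc drawing
   the edge e. Values of g outside E, or of g e outside [0, 1], are irrelevant. *)
Definition plane_drawing (R : realType) (V : finType) (E : {set {set V}})
    (p : V -> R * R) (g : {set V} -> R -> R * R) : Prop :=
  [/\ injective p,
      forall e, e \in E ->
        [/\ {within `[0, 1], continuous (g e)},
            {in `[0, 1] &, injective (g e)} &
            [set g e 0; g e 1] = p @` [set x | x \in e]],
      forall e x, e \in E -> ~ (g e @` `]0, 1[) (p x) &
      forall e e', e \in E -> e' \in E -> e != e' ->
        (g e @` `]0, 1[) `&` (g e' @` `]0, 1[) = set0].

Definition planar (R : realType) (V : finType) (E : {set {set V}}) : Prop :=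
  exists (p : V -> R * R) (g : {set V} -> R -> R * R), plane_drawing E p g.

(* R only serves to define the plane R * R. *)
Definition ex_planar (R : realType) (n : nat) (W : finType)
    (F : {set {set W}}) : nat :=
  \max_(E : {set {set 'I_n}} |
         [&& simple_graph E, `[< planar R E >] & ~~ `[< has_copy F E >]]) #|E|.

(* Main.v *)
Require Import Defs.
From mathcomp Require Import all_boot all_order all_algebra.
From mathcomp Require Import all_classical all_reals all_analysis.
From mathcomp Require Import ring lra zify.
Import Order.TTheory GRing.Theory Num.Theory.
Import numFieldNormedType.Exports.

(* Let T be a stacked triangulation on t vertices without a cycle of length l.
   Join two hubs by k internally disjoint paths, each a string of m copies of T
   ("links") glued end to end at the ends of an edge of T. A cycle inside a link
   does not have length l, and any other cycle runs through two whole paths, hence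
   has length at least 2m > l. The necklace has k(m(t-1)-1)+2 vertices and
   3km(t-2) edges, and it is a subgraph of an Apollonian network, which is drawn
   with straight edges by placing each new vertex at the centroid of its face.

   For the first bound, t = l: a stacked triangulation on l >= 11 vertices with
   5 vertices whose removal leaves 6 components is not Hamiltonian, and
   m = l/2 + 1 < l - 1 makes the necklace dense enough. For the second bound, T is
   the Moon-Moser triangulation of depth d, with at least 3^d vertices: the vertices
   of the deepest level can be cut out of a path, so each level at most doubles the
   order of a longest path, which is less than 2^(d+4). *)

Set Implicit Arguments.
Unset Strict Implicit.
Unset Printing Implicit Defensive.

(** * Addresses *)

Notation letter := (option bool).
Notation address := (seq letter).
Notation L0 := (None : letter).
Notation L1 := (Some true : letter).
Notation L2 := (Some false : letter).

(* The vertices are the addresses of the faces of the infinite Apollonian network,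
   an address standing for the vertex placed at the center of its face. The head
   of an address is the outermost subdivision, and appending a letter [i] to [w]
   replaces corner [i] of the face [w] by its center. Hence [par i w] is
   corner [i] of the face [w]; it is a junk value if [i \notin w], that is, if that
   corner is a corner of the outer triangle. *)
Fixpoint par (i : letter) (w : address) : address :=
  if w is j :: w' then if i \in w' then j :: par i w' else [::] else [::].

Lemma par_catl i w1 w2 : i \in w2 -> par i (w1 ++ w2) = w1 ++ par i w2.
Proof.
by move=> iw2; elim: w1 => [|j w1 IH] //=; rewrite mem_cat iw2 orbT IH.
Qed.

Lemma par_catr i w1 w2 : i \notin w2 -> par i (w1 ++ w2) = par i w1.
Proof.
move=> iw2; elim: w1 => [|j w1 IH] /=; last by rewrite mem_cat (negbTE iw2) orbF IH.
by case: w2 iw2 => [|k w2]; rewrite ?inE ?negb_or => // /andP[_ /negbTE h] /=; rewrite h.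
Qed.

(** Corner [i] was last moved at the last occurrence of [i] in [w], so it is the center of the face
    addressed by the prefix before that letter. *)
Lemma par_split i w : i \in w ->
  exists2 v, w = par i w ++ i :: v & i \notin v.
Proof.
elim: w => //= j w IH; rewrite inE; case: (boolP (i \in w)) => [iw _|iw].
  by have [v vE iv] := IH iw; exists v => //=; rewrite -vE.
by rewrite orbF => /eqP ij; exists w; rewrite // ij.
Qed.

Lemma size_par i w : i \in w -> (size (par i w) < size w)%N.
Proof.
by move=> /par_split[v /(congr1 size) -> _]; rewrite size_cat /= -addSnnS leq_addr.
Qed.

Lemma par_inj w i j : i \in w -> j \in w -> par i w = par j w -> i = j.
Proof.
move=> /par_split[v E _] /par_split[v' E' _] e; move: E; rewrite {1}E' -e => /eqP.
by rewrite eqseq_cat // => /andP[_ /eqP[]].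
Qed.

(** The later vertex comes second: [y] is placed in a face that has [x] as a corner. Every edge is
    thus recorded at its later endpoint. *)
Definition child (x y : address) : bool := x \in [seq par i y | i <- y].

Definition adj (x y : address) : bool := child x y || child y x.

Lemma childP x y : reflect (exists2 i, i \in y & x = par i y) (child x y).
Proof. exact: mapP. Qed.

Lemma adjC x y : adj x y = adj y x.
Proof. exact: orbC. Qed.

Lemma child_par i y : i \in y -> child (par i y) y.
Proof. by move=> iy; apply/childP; exists i. Qed.

Lemma child_size x y : child x y -> size x < size y.
Proof. by case/childP => i iy ->; apply: size_par. Qed.

Lemma adj_size x y : adj x y -> size x != size y.
Proof. by case/orP => /child_size; rewrite neq_ltn => -> //; rewrite orbT. Qed.

(** Both [x] and [y] are prefixes of [z]. If [x] is the shorter, the letter [i] that follows it in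
    [z] does not recur, so it does not recur in [y] either, and [x] is corner [i] of the face
    [y]. *)
Lemma child_clique x y z : child x z -> child y z -> x != y -> adj x y.
Proof.
wlog: x y / size x <= size y => [W|].
  by case: (leqP (size x) (size y)) => [/W//|/ltnW/W h] *; rewrite adjC h // eq_sym.
move=> xy /childP[i iz xE] /childP[j jz yE] nxy.
have [v zE iv] := par_split iz; have [v' zE' _] := par_split jz.
rewrite -xE in zE; rewrite -yE in zE'.
have xlt : size x < size y.
  rewrite ltn_neqAle xy andbT; apply: contra nxy => /eqP e; move: zE.
  by rewrite {1}zE' => /eqP; rewrite eqseq_cat // => /andP[/eqP->].
have yT : y = x ++ i :: take (size y - size x).-1 v.
  have -> : y = take (size y) z by rewrite zE' take_size_cat.
  rewrite {1}zE take_cat ltnNge xy /=.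
  have -> : size (take (size y) z) = size y by rewrite zE' take_size_cat.
  by case: (size y - size x) (subn_gt0 (size x) (size y)) => [|d]; rewrite xlt.
apply/orP; left; apply/childP; exists i; rewrite yT ?mem_cat ?mem_head ?orbT //.
rewrite (@par_catl i x) ?mem_head //=.
by case: ifP => [/mem_take|]; rewrite ?(negbTE iv) // cats0.
Qed.

(* Cutting the vertices outside [P] out of a path: each of them is isolated among
   its like, and its two neighbors on the path are adjacent. *)
Lemma path_filter_half (T : eqType) (e : rel T) (P D : pred T) :
  {in D &, forall x y, e x y -> P x || P y} ->
  {in D & &, forall x y z, ~~ P y -> e x y -> e y z -> x != z -> e x z} ->
  forall s, all D s -> uniq s -> sorted e s ->
  sorted e [seq x <- s | P x] /\ size s <= (size [seq x <- s | P x]).*2.+1.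
Proof.
move=> indep clique.
have main n s x : size s <= n -> P x -> all D (x :: s) -> uniq (x :: s) -> path e x s ->
    path e x [seq x <- s | P x] /\ size s <= (size [seq x <- s | P x]).*2.+1.
  elim: n s x => [|n IH] [|y s] x //= sn Px /and3P[Dx Dy Ds] /and3P[xs ys us] /andP[exy es].
  case: ifPn => [Py|nPy].
    have [? ?] := IH s y sn Py (introT andP (conj Dy Ds)) (introT andP (conj ys us)) es.
    by rewrite /= exy; split=> //; exact: leqW.
  case: s es sn xs ys us Ds => [|z s] //= /andP[eyz es] sn.
  rewrite !inE !negb_or => /and3P[xy xz xs] /andP[yz ys] /andP[zs us] /andP[Dz Ds].
  have := indep _ _ Dy Dz eyz; rewrite (negbTE nPy) /= => Pz; rewrite Pz /=.
  have [? ?] := IH s z (ltnW sn) Pz (introT andP (conj Dz Ds)) (introT andP (conj zs us)) es.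
  by rewrite (clique _ _ _ Dx Dy Dz nPy exy eyz xz); split=> //=; lia.
move=> [|x s] //= /andP[Dx Ds] /andP[xs us] es; case: ifPn => [Px|nPx].
  have [? ?] := main _ s x (leqnn _) Px (introT andP (conj Dx Ds)) (introT andP (conj xs us)) es.
  by split=> //=; lia.
case: s xs us es Ds => [|y s] //= _ /andP[ys us] /andP[exy es] /andP[Dy Ds].
have := indep _ _ Dx Dy exy; rewrite (negbTE nPx) /= => Py; rewrite Py /=.
have [? ?] := main _ s y (leqnn _) Py (introT andP (conj Dy Ds)) (introT andP (conj ys us)) es.
by split=> //=; lia.
Qed.

Lemma path_depth_size d s :
  all (fun x : address => size x <= d) s -> uniq s -> sorted adj s -> size s < 2 ^ d.+1.
Proof.
elim: d s => [|d IH] s Ds us es.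
  have := @uniq_leq_size _ s [:: [::]] us; rewrite expn1; apply=> x /(allP Ds).
  by rewrite leqn0 => /nilP->.
have [] := @path_filter_half _ adj (fun x => size x <= d) (fun x => size x <= d.+1) _ _ s Ds us es.
- by move=> x y; rewrite !unfold_in /= => Dx Dy /adj_size; lia.
- move=> x y z; rewrite !unfold_in /= -ltnNge => Dx Dy Dz dy xy yz xz.
  apply: (child_clique (z := y)) => //.
  + by case/orP: xy => // /child_size; lia.
  + by case/orP: yz => // /child_size; lia.
move=> es' hs; have := IH _ (filter_all _ _) (filter_uniq _ us) es'.
rewrite (expnS 2 d.+1) => lt2.
by apply: leq_ltn_trans hs _; rewrite mul2n -doubleS leq_double.
Qed.

(** * Walking around a cycle *)

Lemma iter_ordS l (a b : 'I_l) : exists t, iter t (@ordS l) a = b.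
Proof.
(* First [l - a] steps around to 0, then [b] more; [b - a] would be truncated. *)
exists (l - a + b); apply: val_inj => /=.
have -> t : val (iter t (@ordS l) a) = (a + t) %% l.
  elim: t => [|t IH] /=; first by rewrite addn0 modn_small.
  by rewrite IH -addn1 modnDml addn1 addnS.
by rewrite addnA subnKC ?modnDl ?modn_small // ltnW.
Qed.

Lemma cyclic_switch l (p : pred 'I_l) a b : p a -> ~~ p b -> exists2 c, p c & ~~ p (ordS c).
Proof.
move=> pa pb; apply/exists_inP; apply: contraNT pb => /exists_inPn h.
have [t <-] := iter_ordS a b; elim: t => //= t IH.
by have /negPn := h _ IH.
Qed.

(** * The drawing *)

Section Geometry.
Local Open Scope ring_scope.
Variable R : realType.
Implicit Types (p q : R * R) (i j : letter) (w : address).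

(* The affine map from the triangle [base] onto the triangle obtained from it by
   moving corner [i] to the centroid. *)
Definition shrink i p : R * R :=
  match i with
  | None => (p.1 / 3, p.2 + p.1 / 3)
  | Some true => (p.1 + p.2 / 3, p.2 / 3)
  | Some false => (p.1 + (1 - p.1 - p.2) / 3, p.2 + (1 - p.1 - p.2) / 3)
  end.

Definition base i : R * R :=
  match i with None => (1, 0) | Some true => (0, 1) | Some false => (0, 0) end.

Fixpoint center w : R * R :=
  if w is j :: w' then shrink j (center w') else (3^-1, 3^-1).

(** Corner [i] of the face [w], also when it is a corner of the outer triangle and hence not a
    vertex. *)
Fixpoint apex w i : R * R :=
  if w is j :: w' then shrink j (apex w' i) else base i.

Definition seg p q (s : R) : R * R :=
  ((1 - s) * p.1 + s * q.1, (1 - s) * p.2 + s * q.2).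

Definition inside p := [&& 0 < p.1, 0 < p.2 & p.1 + p.2 < 1].

Lemma shrink_seg j p q s : shrink j (seg p q s) = seg (shrink j p) (shrink j q) s.
Proof. by case: j => [[]|]; rewrite /seg /=; congr pair; field. Qed.

Lemma seg_cons j w i s :
  seg (center (j :: w)) (apex (j :: w) i) s = shrink j (seg (center w) (apex w i) s).
Proof. by rewrite shrink_seg. Qed.

Lemma shrink_inj j : injective (shrink j).
Proof.
by case: j => [[]|] [a b] [c d] /= [E1 E2]; congr pair; lra.
Qed.

Lemma shrink_inside j p : inside p -> inside (shrink j p).
Proof.
by case/and3P=> a b c; case: j => [[]|]; apply/and3P => /=; split; lra.
Qed.

Lemma seg_inside w i s : 0 <= s < 1 -> inside (seg (center w) (apex w i) s).
Proof.
move=> /andP[s0 s1]; elim: w => [|j w IH]; last by rewrite seg_cons shrink_inside.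
by case: i => [[]|]; apply/and3P; rewrite /seg /=; split; lra.
Qed.

Lemma shrink_disjoint j j' p q : inside p -> inside q ->
  shrink j p = shrink j' q -> j = j'.
Proof.
case: p q => [a b] [c d] /and3P[/= ? ? ?] /and3P[/= ? ? ?].
by case: j => [[]|]; case: j' => [[]|] //= [? ?]; exfalso; lra.
Qed.

(** The three segments from the centroid lie on the boundaries of the three subtriangles. *)
Lemma seg_nil_outside j i s q : 0 <= s < 1 -> inside q ->
  seg (center [::]) (apex [::] i) s <> shrink j q.
Proof.
case: q => [c d] /andP[? ?] /and3P[/= ? ? ?].
by case: j => [[]|]; case: i => [[]|] //= [? ?]; lra.
Qed.

(* Taking [s = 0] gives the vertex [center w] itself, so this single statement says
   that vertices and open edges are pairwise disjoint. *)
Lemma seg_disjoint w w' i i' s s' : 0 <= s < 1 -> 0 <= s' < 1 ->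
  seg (center w) (apex w i) s = seg (center w') (apex w' i') s' ->
  [/\ w = w', s = s' & s = 0 \/ i = i'].
Proof.
move=> hs hs'; elim: w w' => [|j w IH] [|j' w'].
- case/andP: hs hs' => s0 s1 /andP[s0' s1'].
  have [->|ii'] := eqVneq i i'.
    case: i' => [[]|] /= [? ?]; (split; [by []|lra|by right]).
  case: i i' ii' => [[]|] [[]|] //= _ [? ?]; (split; [by []|lra|left; lra]).
- by rewrite seg_cons => /seg_nil_outside[] //; apply: seg_inside.
- by rewrite seg_cons => /esym/seg_nil_outside[] //; apply: seg_inside.
rewrite !seg_cons => e.
have jj := shrink_disjoint (seg_inside _ _ hs) (seg_inside _ _ hs') e.
by subst j'; have [-> ? ?] := IH _ (shrink_inj e).
Qed.

Lemma seg0 p q : seg p q 0 = p.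
Proof. by case: p => a b; rewrite /seg /=; congr pair; ring. Qed.

Lemma seg1 p q : seg p q 1 = q.
Proof. by case: q => a b; rewrite /seg /=; congr pair; ring. Qed.

Lemma seg_inj p q : p <> q -> injective (seg p q).
Proof.
case: p q => [a b] [c d] pq s s' [/= e1 e2].
apply/eqP; rewrite -subr_eq0; apply/negPn/negP => ss; apply: pq; congr pair.
- apply/(mulfI ss); lra.
- apply/(mulfI ss); lra.
Qed.

Lemma center_inj : injective center.
Proof.
move=> w w' e; have [] // := @seg_disjoint w w' L0 L0 0 0 _ _ _; rewrite ?lexx ?ltr01 //.
by rewrite !seg0.
Qed.

(** [shrink j] moves only corner [j] of the base triangle. *)
Lemma apex_notin w i : i \notin w -> apex w i = base i.
Proof.
elim: w => //= j w IH; rewrite inE negb_or => /andP[ij /IH->].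
by clear IH; case: i j ij => [[]|] [[]|] //= _; congr pair; field.
Qed.

Lemma apex_par w i : i \in w -> apex w i = center (par i w).
Proof.
elim: w => //= j w IH; rewrite inE; case: (boolP (i \in w)) => [/IH->//|iw].
rewrite orbF => /eqP ij; rewrite -ij apex_notin //.
by case: (i) => [[]|] /=; congr pair; field.
Qed.

Local Open Scope classical_set_scope.

Lemma seg_continuous p q : continuous (seg p q).
Proof.
move=> s.
have h (a b : R) : (fun t => (1 - t) * a + t * b) @ s --> (1 - s) * a + s * b.
  by apply: cvgD; apply: cvgM; try apply: cvgB; try exact: cvg_cst; exact: cvg_id.
exact: (cvg_pair (h p.1 q.1) (h p.2 q.2)).
Qed.

Lemma planar_of_addresses (V : finType) (E : {set {set V}}) (nu : V -> address) :
  injective nu ->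
  (forall e, e \in E -> exists x y i,
     [/\ e = [set x; y]%SET, i \in nu x & nu y = par i (nu x)]) ->
  planar R E.
Proof.
move=> nu_inj hE.
(* [c e] codes the edge [e] by the face of its later endpoint and the corner it leads to; it is
   drawn as the segment from the center to that corner. *)
have /boolp.choice[c hc] : forall e : {set V}, exists c : address * letter, e \in E ->
    exists x y, [/\ e = [set x; y]%SET, nu x = c.1, c.2 \in c.1 & nu y = par c.2 c.1].
  move=> e; case: (boolP (e \in E)) => [/hE[x [y [i [? ? ?]]]]|eE].
    by exists (nu x, i) => _; exists x, y.
  by exists ([::], L0).
pose g e := seg (center (c e).1) (apex (c e).1 (c e).2).
have s0 : 0 <= (0 : R) < 1 by rewrite lexx ltr01.
have itv (s : R) : `]0, 1[%classic s -> (0 <= s < 1)%R.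
  by rewrite /= in_itv /= => /andP[/ltW-> ->].
exists (center \o nu), g; split.
- exact: inj_comp center_inj nu_inj.
- move=> e /hc[x [y [eE xE ic yE]]]; split.
  + exact/continuous_subspaceT/seg_continuous.
  + move=> s s' _ _; apply: seg_inj; rewrite apex_par // => /center_inj.
    by move/(congr1 size) => h; have := size_par ic; rewrite -h ltnn.
  + rewrite /g seg0 seg1 apex_par // -yE -xE eE; apply/seteqP; split => [p /= [->|->]|p /= [z]].
    * by exists x => //; rewrite !inE eqxx.
    * by exists y => //; rewrite !inE eqxx orbT.
    * by rewrite !inE => /orP[] /eqP-> <-; [left|right].
- move=> e x /hc[y [z [eE yE ic zE]]] [s hs /=]; rewrite -(seg0 (center (nu x)) (apex (nu x) L0)).
  move=> /seg_disjoint[] //; first exact: itv.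
  by move=> _ s00 _; move: hs; rewrite /= s00 in_itv /= ltxx.
- move=> e e' /hc[x [y [eE xE ic yE]]] /hc[x' [y' [eE' xE' ic' yE']]] /eqP ee'.
  rewrite -subset0 => p /= [[s hs <-] [s' hs']] /seg_disjoint[]; try exact: itv.
  move=> w1 ss [s00|i1]; first by move: hs; rewrite /= -ss s00 in_itv /= ltxx.
  apply: ee'; rewrite eE eE'; congr [set _; _]%SET; apply: nu_inj.
    by rewrite xE xE'.
  by rewrite yE yE' w1 i1.
Qed.
End Geometry.

(** * Necklaces of links *)

Lemma nseq_cat_inj (T : eqType) (x : T) a b s t :
  ohead s != Some x -> ohead t != Some x -> nseq a x ++ s = nseq b x ++ t ->
  a = b /\ s = t.
Proof.
move=> sx tx; elim: a b => [|a IH] [|b] //=.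
- by move=> e; move: sx; rewrite e eqxx.
- by move=> e; move: tx; rewrite -e eqxx.
by case=> /IH[-> ->].
Qed.

(* A link is a stacked triangulation with outer triangle [::], [:: L0], [:: L0; L1];
   it is attached by its terminals [::] and [:: L0]. *)
Definition leaves (U : seq address) : seq address := [::] :: [seq L2 :: u | u <- U].

(** The corners of the face [[:: L0; L1; L2]] are the two terminals and [[:: L0; L1]]; [U] lists,
    relative to this face, the faces that are subdivided. *)
Definition link (U : seq address) : seq address :=
  [:: [::], [:: L0] & [seq L0 :: L1 :: w | w <- leaves U]].

(** With [i] the last letter of [u], this gives closure under prefixes: a face is subdivided only
    after the faces around it. *)
Definition par_closed (U : seq address) : Prop :=
  forall u i, u \in U -> i \in u -> par i u \in U.

Lemma leafP U w : w \in leaves U -> w = [::] \/ exists2 u, w = L2 :: u & u \in U.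
Proof. by rewrite inE => /predU1P[->|/mapP[u uU ->]]; [left | right; exists u]. Qed.

Lemma leaves_par U w i : par_closed U -> w \in leaves U -> i \in w -> par i w \in leaves U.
Proof.
move=> cU /leafP[->//|[u -> uU]] /=; case: ifP => [iu _|_ _]; last exact: mem_head.
by rewrite inE /=; apply/mapP; exists (par i u); first exact: cU.
Qed.

Lemma linkP U y : y \in link U ->
  [\/ y = [::], y = [:: L0] | exists2 w, y = L0 :: L1 :: w & w \in leaves U].
Proof.
rewrite inE => /predU1P[->|]; first by constructor 1.
rewrite inE => /predU1P[->|/mapP[w wW ->]]; first by constructor 2.
by constructor 3; exists w.
Qed.

Lemma mem_link U w : w \in leaves U -> L0 :: L1 :: w \in link U.
Proof. by move=> wW; rewrite 2!in_cons map_f ?orbT. Qed.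

Lemma link_par U y i : par_closed U -> y \in link U -> i \in y -> par i y \in link U.
Proof.
move=> cU /linkP[->//|->|[w -> wW]]; first by rewrite !inE => /eqP->.
case: (boolP (i \in w)) => iw.
  by rewrite (@par_catl i [:: L0; L1]) //= => _; exact/mem_link/leaves_par.
rewrite (@par_catr i [:: L0; L1]) // !inE (negbTE iw) orbF.
by move=> /orP[] /eqP->.
Qed.

Lemma uniq_link U : uniq U -> uniq (link U).
Proof.
move=> uU; have uW : uniq (leaves U).
  by rewrite /= map_inj_uniq ?uU ?andbT // => [|x y []//]; apply/mapP => -[].
rewrite [link _]lock -lock /link; rewrite 2!cons_uniq map_inj_uniq; last by move=> x y [].
by rewrite uW !inE /= andbT; apply/andP; split; apply/mapP => -[].
Qed.

Lemma size_link U : size (link U) = (size U).+3.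
Proof. by rewrite /= !size_map. Qed.

Section Necklace.
Variables (U : seq address) (m : nat).
Hypothesis m_gt1 : 1 < m.

(* Path [j] of the necklace runs from the hub [::] to the hub [:: L0]; its knots
   subdivide the face [:: L0; L1; L2] ++ nseq j L2, which has both hubs as corners. *)
Definition trunk j i : address := [:: L0; L1; L2] ++ nseq j L2 ++ nseq i L0.

Definition knot j i : address :=
  if i == 0 then [::] else if i == m then [:: L0] else trunk j i.-1.

(** The face for link [i] of path [j]: its corners L0 and L1 are the knots [i] and [i.+1]. In the
    last link, corner L1 of [trunk j i] is already the hub [[:: L0]]. *)
Definition face j i : address := if i.+1 < m then rcons (trunk j i) L1 else trunk j i.

Definition place (p : nat * nat) (y : address) : address :=
  match y with
  | [::] => knot p.1 p.2
  | [:: _] => knot p.1 p.2.+1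
  | [:: _, _ & w] => face p.1 p.2 ++ w
  end.

(** The run lengths can be read off because [s] does not prolong the run of L0, nor that of L2 when
    the run of L0 is empty. *)
Lemma trunk_inj j i s j' i' s' :
  ohead s != Some L0 -> (0 < i) || (ohead s != Some L2) ->
  ohead s' != Some L0 -> (0 < i') || (ohead s' != Some L2) ->
  trunk j i ++ s = trunk j' i' ++ s' -> [/\ j = j', i = i' & s = s'].
Proof.
move=> s0 s2 s0' s2'; rewrite /trunk -!catA => /eqP; rewrite eqseq_cat // eqxx /= => /eqP.
case/nseq_cat_inj => [||-> /nseq_cat_inj[]//].
  by case: i s2.
by case: i' s2'.
Qed.

Lemma knotS j i : i.+1 < m -> knot j i.+1 = trunk j i.
Proof. by rewrite /knot /= => im; rewrite ltn_eqF. Qed.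

Lemma knot_inj j i j' i' : i <= m -> i' <= m -> knot j i = knot j' i' ->
  i = i' /\ [\/ j = j', i = 0 | i = m].
Proof.
rewrite /knot => im im'.
case: (i =P 0) => [->|i0]; case: (i' =P 0) => [->|i0'].
- by split=> //; constructor 2.
- by case: eqP.
- by case: eqP.
case: (i =P m) => [->|im1]; case: (i' =P m) => [->|im1'] //.
  by split=> //; constructor 3.
rewrite -[trunk j _]cats0 -[trunk j' _]cats0.
case/trunk_inj => //; rewrite ?orbT // => -> ii _; split; last by constructor 1.
by lia.
Qed.

Lemma knot_face j i j' i' w : i <= m -> i' < m -> w \in leaves U ->
  knot j i <> face j' i' ++ w.
Proof.
move=> im im' wW; rewrite /knot /face.
have trunk_big a b s : [:: L0] <> trunk a b ++ s by [].
case: eqP => [_|i0]; first by case: ifP => _; rewrite -?cats1.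
case: eqP => [_|im1]; first by case: ifP => _; rewrite -?cats1.
rewrite -[trunk j _]cats0; case: ifP => h; rewrite ?cat_rcons.
  by case/trunk_inj => //; rewrite ?orbT.
case/trunk_inj => //; rewrite ?orbT //; try by case/leafP: wW => [->|[u ->]].
  by rewrite (_ : 0 < i') //; lia.
by move=> _; lia.
Qed.

Lemma face_inj j i w j' i' w' : i < m -> i' < m -> w \in leaves U -> w' \in leaves U ->
  face j i ++ w = face j' i' ++ w' -> [/\ j = j', i = i' & w = w'].
Proof.
(* Brings the address into the form required by [trunk_inj]. The suffix [v] may begin with L2, but
   when it follows the trunk directly the link is the last one, and [0 < a] because [1 < m]. *)
have aux a v : a < m -> v \in leaves U ->
  exists s, [/\ forall b, face b a ++ v = trunk b a ++ s, ohead s != Some L0,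
    (0 < a) || (ohead s != Some L2) & s = if a.+1 < m then L1 :: v else v].
  move=> am vW; exists (if a.+1 < m then L1 :: v else v).
  split=> //; first by move=> b; rewrite /face; case: ifP; rewrite ?cat_rcons.
    by case: ifP => // _; case/leafP: vW => [->|[u ->]].
  by case: ifP => h; rewrite ?orbT // (_ : 0 < a) //; lia.
move=> im im' wW wW'; have [s [E s0 s2 sE]] := aux i w im wW.
have [s' [E' s0' s2' sE']] := aux i' w' im' wW'.
rewrite E E' => /trunk_inj[] // -> ii; rewrite sE sE' ii.
by case: ifP => _ => [[->]|->].
Qed.

Lemma place_inj p : p.2 < m -> {in link U &, injective (place p)}.
Proof.
case: p => j i /= im.
move=> y y' /linkP[->|->|[w -> wW]] /linkP[->|->|[w' -> wW']] //=.
- by case/knot_inj => //; lia.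
- by move/knot_face; case; rewrite // ltnW.
- by case/knot_inj => //; lia.
- by move/knot_face; case.
- by move/esym/knot_face; case; rewrite // ltnW.
- by move/esym/knot_face; case.
by case/face_inj => // _ _ ->.
Qed.

Lemma place_share p q y z : p.2 < m -> q.2 < m -> y \in link U -> z \in link U ->
  place p y = place q z -> p = q /\ y = z \/
  exists2 a, (p.2 <= a <= p.2.+1) && (q.2 <= a <= q.2.+1) &
    place p y = knot p.1 a /\ [\/ p.1 = q.1, a = 0 | a = m].
Proof.
case: p q => [j i] [j' i'] /= im im'.
have knots a b : i <= a <= i.+1 -> i' <= b <= i'.+1 -> knot j a = knot j' b ->
  exists2 c, (i <= c <= i.+1) && (i' <= c <= i'.+1) &
    knot j a = knot j c /\ [\/ j = j', c = 0 | c = m].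
  move=> ha hb /knot_inj[||ab jj]; try by lia.
  by subst b; exists a; rewrite ?ha ?hb.
move=> /linkP[->|->|[w -> wW]] /linkP[->|->|[w' -> wW']] /=.
- by move/knots => h; right; apply: h; lia.
- by move/knots => h; right; apply: h; lia.
- by move/knot_face; case; rewrite // ltnW.
- by move/knots => h; right; apply: h; lia.
- by move/knots => h; right; apply: h; lia.
- by move/knot_face; case.
- by move/esym/knot_face; case; rewrite // ltnW.
- by move/esym/knot_face; case.
by case/face_inj => // -> -> ->; left.
Qed.

(** Distinct links share only knots. Two common knots force the same position in the path, and on
    different paths they would be both hubs, which no single link joins as [1 < m]. Hence copies of
    edges in different links are different. *)
Lemma place_share2 p q y z y' z' : p.2 < m -> q.2 < m ->
  y \in link U -> z \in link U -> y' \in link U -> z' \in link U ->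
  place p y = place q z -> place p y' = place q z' -> y != y' -> p = q.
Proof.
move=> pm qm yX zX yX' zX' /(place_share pm qm yX zX)[[-> _]//|[a ha [ea ja]]].
move=> /(place_share pm qm yX' zX')[[-> _]//|[b hb [eb jb]]] nyy.
have ab : a <> b.
  move=> ab; case/eqP: nyy; apply: (place_inj pm) => //; by rewrite ea eb ab.
case: p q pm qm ha hb ja jb {ea eb} => [j i] [j' i'] /= pm qm ha hb ja jb.
have -> : i = i' by lia.
case: ja => [->//|a0|am]; case: jb => [->//|b0|bm]; exfalso; lia.
Qed.
End Necklace.

Definition link_free (l : nat) (U : seq address) : Prop :=
  forall F : 'I_l -> address, injective F -> (forall c, F c \in link U) ->
    (forall c, adj (F c) (F (ordS c))) -> False.

Section Assembly.
Variables (U : seq address) (m : nat).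
Hypothesis m_gt1 : 1 < m.

(* A cycle not contained in one link passes from each link it meets to the next
   one at every terminal, hence it runs through all the links of two paths. *)
Lemma necklace_cycle_free l (F : 'I_l -> address) :
  injective F -> l < 2 * m -> link_free l U ->
  (forall c, exists p y z, [/\ p.2 < m, y \in link U, z \in link U, adj y z &
     F c = place m p y /\ F (ordS c) = place m p z]) -> False.
Proof.
move=> F_inj lm free.
move=> /fin_all_exists[P /fin_all_exists[y /fin_all_exists[z H]]].
have Pm c : (P c).2 < m by case: (H c).
have yX c : y c \in link U by case: (H c).
have zX c : z c \in link U by case: (H c).
have Fy c : F c = place m (P c) (y c) by case: (H c) => _ _ _ _ [].
have Fz c : F (ordS c) = place m (P c) (z c) by case: (H c) => _ _ _ _ [].
have [c1 nc1 |allP] := pickP (fun c => [exists d, P d != P c]); last first.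
  have PP c d : P c = P d.
    by apply/eqP/negPn/negP => h; have /existsP[] := allP d; exists c.
  apply: (free y) => // [c d ycd|c]; first by apply: F_inj; rewrite !Fy ycd (PP c d).
  suff <- : z c = y (ordS c) by case: (H c).
  by apply: (place_inj m_gt1 (Pm c)) => //; rewrite -Fz Fy (PP c (ordS c)).
pose used p := exists c, P c = p.
have other p : exists c, P c != p.
  have [d dc1] := existsP nc1; have [<-|h] := eqVneq (P c1) p; first by exists d.
  by exists c1.
(* The cycle leaves link [p] after edge [c] and enters it after edge [d]. The two vertices where
   this happens are distinct by injectivity of [F], so they are the two terminals of [p], and knot
   [a] is one of them. *)
have K p a : used p -> p.2 <= a <= p.2.+1 -> exists q,
    [/\ used q, q != p, q.2 <= a <= q.2.+1 & [\/ p.1 = q.1, a = 0 | a = m]].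
  move=> [c0 Pc0] ha; have [d0 Pd0] := other p.
  have [c /eqP Pc Pc'] := cyclic_switch (p := fun c => P c == p) (introT eqP Pc0) Pd0.
  have [d Pd /negPn/eqP Pd'] :=
    cyclic_switch (p := fun c => P c != p) Pd0 (introT negPn (introT eqP Pc0)).
  have pm : p.2 < m by rewrite -Pc.
  have cd : c <> d by move=> cd; move: Pd; rewrite -cd Pc eqxx.
  have [[pq _]|[a1 h1 [e1 k1]]] := place_share m_gt1 pm (Pm (ordS c)) (zX c) (yX (ordS c))
    (etrans (etrans (esym (congr1 (fun q => place m q (z c)) Pc)) (esym (Fz c))) (Fy (ordS c))).
    by move: Pc'; rewrite -pq eqxx.
  have [[pq _]|[a2 h2 [e2 k2]]] := place_share m_gt1 pm (Pm d) (yX (ordS d)) (zX d)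
    (etrans (etrans (esym (congr1 (fun q => place m q (y (ordS d))) Pd'))
      (esym (Fy (ordS d)))) (Fz d)).
    by move: Pd; rewrite -pq eqxx.
  have a12 : a1 <> a2.
    move=> a12; apply: cd; apply: (can_inj (@ordSK l)); apply: F_inj.
    by rewrite (Fz c) Pc e1 (Fy (ordS d)) Pd' e2 a12.
  have [->|->] : a = a1 \/ a = a2 by lia.
    exists (P (ordS c)); split=> //; first by exists (ordS c).
    by case/andP: h1.
  exists (P d); split=> //; first by exists d.
  by case/andP: h2.
(* An inner knot belongs to only two links, consecutive on the same path. *)
have up j i : used (j, i) -> i.+1 < m -> used (j, i.+1).
  move=> uji im; have [//=|[j' i'] [uq nq /= hq jq]] := K _ i.+1 uji; first lia.
  have jj : j = j' by case: jq => // h; exfalso; lia.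
  subst j'; suff <- : i' = i.+1 by [].
  have /eqP ne : i' != i by apply: contra nq => /eqP->.
  lia.
have down j i : used (j, i.+1) -> used (j, i).
  move=> uji; have im : i.+1 < m by case: uji => c Pc; have := Pm c; rewrite Pc.
  have [//=|[j' i'] [uq nq /= hq jq]] := K _ i.+1 uji; first lia.
  have jj : j = j' by case: jq => // h; exfalso; lia.
  subst j'; suff <- : i' = i by [].
  have /eqP ne : i' != i.+1 by apply: contra nq => /eqP->.
  lia.
have full j i : used (j, i) -> forall a, a < m -> used (j, a).
  move=> uji; have u0 : used (j, 0) by elim: i uji => // i IH /down.
  by elim=> // a IH am; apply: up => //; apply: IH; apply: ltnW.
have [j u0] : exists j, used (j, 0).
  exists (P c1).1; apply: (full _ (P c1).2); last exact: ltnW.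
  by exists c1; case: (P c1).
have [//|[j' i'] [uq nq /= hq jq]] := K _ 0 u0.
have i'0 : i' = 0 by lia.
subst i'; have /eqP jj' : j' != j by apply: contra nq => /eqP->.
(* At the hub the cycle passes to another path [j']. One cycle edge in each of the [2 * m] links of
   both paths gives [2 * m <= l]. *)
have /fin_all_exists[g hg] (bi : bool * 'I_m) :
    exists c, P c = (if bi.1 then j else j', val bi.2).
  by case: bi => -[] i /=; [apply: (full _ _ u0) | apply: (full _ _ uq)].
have /leq_card : injective g.
  move=> [b i] [b' i'] /(congr1 P); rewrite !hg /= => -[jb /val_inj ->].
  by case: b b' jb => [] [] // h; case: jj'.
by rewrite card_prod card_bool !card_ord leqNgt lm.
Qed.

Lemma par_trunk0 j i : i < m -> par L0 (trunk j i) = knot m j i.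
Proof.
case: i => [|i] im.
  by rewrite /trunk cats0 (@par_catr L0 [:: L0; L1; L2]) ?mem_nseq ?andbF.
rewrite knotS // /trunk -[in LHS](addn1 i) nseqD !catA.
by rewrite par_catl ?mem_head //= cats0.
Qed.

Lemma par_trunk1 j i : par L1 (trunk j i) = [:: L0].
Proof. by rewrite /trunk (@par_catr L1 [:: L0; L1; L2]) // mem_cat !mem_nseq !andbF. Qed.

Lemma adj_knot j i : i < m -> adj (knot m j i) (knot m j i.+1).
Proof.
move=> im; have [i1m|] := ltnP i.+1 m.
  rewrite knotS //; apply/orP; left; rewrite -(par_trunk0 j im).
  by apply: child_par; rewrite mem_head.
case: i im => [|i] im mi; first by lia.
have -> : knot m j i.+2 = [:: L0] by rewrite /knot /= (_ : i.+2 == m) //; lia.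
rewrite knotS //; apply/orP; right; rewrite -(par_trunk1 j i).
by apply: child_par; rewrite !inE.
Qed.

Lemma mem_face j i c : c != L2 -> c \in face m j i.
Proof.
move=> c2; rewrite /face; case: ifP => _; rewrite ?mem_rcons ?inE.
  by rewrite /trunk !mem_cat /= orbC; case: c c2 => [[]|].
by rewrite /trunk mem_cat; case: c c2 => [[]|].
Qed.

Lemma par_face0 j i : i < m -> par L0 (face m j i) = knot m j i.
Proof.
move=> im; rewrite /face; case: ifP => _; last exact: par_trunk0.
by rewrite -cats1 par_catr ?par_trunk0.
Qed.

Lemma par_face1 j i : i < m -> par L1 (face m j i) = knot m j i.+1.
Proof.
move=> im; rewrite /face; case: ifP => i1m.
  by rewrite -cats1 par_catl ?mem_head //= cats0 knotS.
rewrite par_trunk1 /knot /= (_ : i.+1 == m) //; lia.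
Qed.

(** Only [adj] is preserved, not [child]: in the last link of a path the second terminal is a hub,
    older than the first terminal. *)
Lemma adj_place p y c : p.2 < m -> y \in link U -> c \in y ->
  adj (place m p (par c y)) (place m p y).
Proof.
case: p => j i /= im /linkP[->//|->|[w -> wW]].
  by rewrite inE => /eqP-> /=; apply: adj_knot.
case: (boolP (c \in w)) => cw.
  rewrite (@par_catl c [:: L0; L1]) //= => _.
  by rewrite -par_catl //; apply/orP; left; apply: child_par; rewrite mem_cat cw orbT.
rewrite (@par_catr c [:: L0; L1]) // !inE (negbTE cw) orbF.
move=> /orP[] /eqP cE; rewrite cE in cw *; apply/orP; left; rewrite /=.
  rewrite -(par_face0 j im) -(par_catr _ cw); apply: child_par.
  by rewrite mem_cat mem_face.
rewrite -(par_face1 j im) -(par_catr _ cw); apply: child_par.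
by rewrite mem_cat mem_face.
Qed.

Definition beads k : seq address :=
  [:: [::]; [:: L0]] ++ [seq knot m j i | j <- iota 0 k, i <- iota 1 m.-1] ++
  [seq v ++ w | v <- [seq face m j i | j <- iota 0 k, i <- iota 0 m], w <- leaves U].

Lemma size_beads k : size (beads k) = k * (m * (size U).+2 - 1) + 2.
Proof.
rewrite !size_cat !size_allpairs !size_iota /= !size_map /=.
by case: m m_gt1 => // m' _; rewrite /= mulSn; lia.
Qed.

Lemma mem_beads k p y : p.1 < k -> p.2 < m -> y \in link U -> place m p y \in beads k.
Proof.
have knots j i : j < k -> i <= m -> knot m j i \in beads k.
  move=> jk im; rewrite !mem_cat; case: (i =P 0) => [->|i0]; first by rewrite /knot inE.
  case: (i =P m) => [->|im1].
    by rewrite /knot eqxx; case: ifP => _; rewrite !inE ?eqxx ?orbT.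
  apply/orP; right; apply/orP; left; apply/allpairsP; exists (j, i) => /=.
  by rewrite !mem_iota; split=> //; lia.
case: p => j i /= jk im /linkP[->|->|[w -> wW]] /=; try by apply: knots => //; lia.
rewrite !mem_cat; apply/orP; right; apply/orP; right.
apply/allpairsP; exists (face m j i, w); split=> //=.
by apply/allpairsP; exists (j, i); rewrite !mem_iota.
Qed.

(** Each edge is counted at its later endpoint: the corners of the outer triangle contribute 0, 1
    and 2, every inner vertex 3. *)
Lemma link_edges_card (X := link U) :
  #|[set xc : 'I_(size X) * letter | xc.2 \in nth [::] X xc.1]| = 3 * (size U).+1.
Proof.
rewrite cardsE -sum1_card.
rewrite (eq_bigl (fun xc : 'I_(size X) * letter => xc.2 \in nth [::] X xc.1)) //.
rewrite -(@pair_big_dep _ _ _ _ _ xpredT (fun x c => c \in nth [::] X (nat_of_ord x))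
  (fun _ _ => 1)) /=.
under eq_bigr do rewrite sum1_card.
rewrite -(@big_mkord _ _ _ _ xpredT (fun x => #|[pred c | c \in nth [::] X x]|)).
rewrite -(@big_nth _ _ _ _ [::] X xpredT (fun w => #|[pred c | c \in w]|)).
rewrite /X /link !big_cons !big_map.
rewrite (eq_bigr (fun=> 3)) => [|u _]; last first.
  by rewrite (eq_card (B := predT)) ?card_option ?card_bool // => -[[]|].
have card_letters (s : address) : uniq s -> #|[pred c in s]| = size s.
  by move=> /card_uniqP <-; apply: eq_card.
rewrite big_const_seq count_predT iter_addn_0 !card_letters //=.
by rewrite mulnS !addnA.
Qed.
End Assembly.

(** * Necklaces as labelled graphs *)

Lemma address_extend (s : seq address) n : uniq s -> size s <= n ->
  exists nu : 'I_n -> address, injective nu /\ {in s, forall x, exists v, nu v = x}.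
Proof.
move=> us sn; have [s' [us' ss' sz]] : exists s', [/\ uniq s', {subset s <= s'} & size s' = n].
  elim: n sn => [|n IH]; first by move=> sn; exists s; split=> //; apply/eqP; rewrite -leqn0.
  rewrite leq_eqVlt => /predU1P[sn|/IH[s' [us' ss' sz]]]; first by exists s; split.
  (* A fresh address, being longer than all the others. *)
  pose x : address := nseq (\max_(y <- s') size y).+1 L0.
  exists (x :: s'); split=> /=; last by rewrite sz.
    rewrite us' andbT; apply/negP => xs'.
    by have := @leq_bigmax_seq _ s' xpredT (@size letter) x xs' isT; rewrite size_nseq ltnn.
  by move=> y ys; rewrite inE ss' ?orbT.
exists (fun v : 'I_n => nth [::] s' v); split.
  by move=> v w /eqP; rewrite nth_uniq ?sz // => /eqP/val_inj.
move=> x /ss' xs; have xn : index x s' < n by rewrite -sz index_mem.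
by exists (Ordinal xn); rewrite /= nth_index.
Qed.

Lemma ex_planar_ge (R : realType) (U : seq address) (m l k n : nat) :
  uniq U -> par_closed U -> (1 < m)%N -> (l < 2 * m)%N -> link_free l U ->
  (k * (m * (size U).+2 - 1) + 2 <= n)%N ->
  (3 * (k * m * (size U).+1) <= ex_planar R n (cycle_graph l))%N.
Proof.
move=> uU cU m1 lm free kn.
(* An upper bound on the number of beads suffices here. The remaining vertices get fresh addresses
   and stay isolated. *)
have [|nu [nu_inj nu_sur]] := @address_extend (undup (beads U m k)) n (undup_uniq _).
  by apply: leq_trans (size_undup _) _; rewrite size_beads.
have n_gt0 : (0 < n)%N by apply: leq_trans kn; rewrite addn2.
pose lab a := odflt (Ordinal n_gt0) [pick v | nu v == a].
have labK a : a \in beads U m k -> nu (lab a) = a.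
  rewrite -mem_undup /lab => /nu_sur[v va]; case: pickP => [w /eqP//|/(_ v)].
  by rewrite va eqxx.
pose X := link U.
pose D := [set z : ('I_k * 'I_m) * ('I_(size X) * letter) | z.2.2 \in nth [::] X z.2.1]%SET.
pose pos (z : ('I_k * 'I_m) * ('I_(size X) * letter)) := (val z.1.1, val z.1.2).
pose top (z : ('I_k * 'I_m) * ('I_(size X) * letter)) := nth [::] X z.2.1.
pose ends z := [set lab (place m (pos z) (top z)); lab (place m (pos z) (par z.2.2 (top z)))]%SET.
pose E := (ends @: D)%SET.
have pm z : ((pos z).2 < m)%N by exact: ltn_ord.
have pk z : ((pos z).1 < k)%N by exact: ltn_ord.
have topX z : top z \in X by apply: mem_nth.
have parX z : z \in D -> par z.2.2 (top z) \in X by rewrite inE => zD; apply: link_par.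
have top_lt z : z \in D -> (size (par z.2.2 (top z)) < size (top z))%N.
  by rewrite inE => /size_par.
have tpar z : z \in D -> top z != par z.2.2 (top z).
  by move=> /top_lt; apply: contraTneq => <-; rewrite ltnn.
have labP z y : y \in X -> nu (lab (place m (pos z) y)) = place m (pos z) y.
  by move=> yX; apply: labK; exact: (mem_beads m1 (pk z) (pm z) yX).
have lab_inj z z' y y' : y \in X -> y' \in X ->
    lab (place m (pos z) y) = lab (place m (pos z') y') -> place m (pos z) y = place m (pos z') y'.
  by move=> yX yX' e; rewrite -(labP z y yX) e labP.
have lab_neq z : z \in D ->
    lab (place m (pos z) (top z)) != lab (place m (pos z) (par z.2.2 (top z))).
  move=> zD; apply/eqP => /(lab_inj _ _ _ _ (topX z) (parX _ zD)) e.
  by case/eqP: (tpar _ zD); apply: (place_inj m1 (pm z) (topX z) (parX _ zD) e).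
have setP2 (T : finType) (a b c d : T) : a != b -> [set a; b]%SET = [set c; d]%SET ->
    (a = c /\ b = d) \/ (a = d /\ b = c).
  move=> ab e; have := set21 a b; have := set22 a b; rewrite e !inE.
  by move=> /orP[] /eqP bE /orP[] /eqP aE; auto; case/eqP: ab; rewrite aE bE.
have ends_inj : {in D &, injective ends}.
  move=> z z' zD zD' /(setP2 _ _ _ _ _ (lab_neq _ zD)).
  have key y y' : y \in X -> y' \in X ->
     lab (place m (pos z) (top z)) = lab (place m (pos z') y) ->
     lab (place m (pos z) (par z.2.2 (top z))) = lab (place m (pos z') y') ->
     [/\ pos z = pos z', top z = y & par z.2.2 (top z) = y'].
    move=> yX yX' /(lab_inj _ _ _ _ (topX z) yX) e1 /(lab_inj _ _ _ _ (parX _ zD) yX') e2.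
    have pp : pos z = pos z' :=
      place_share2 m1 (pm z) (pm z') (topX z) yX (parX _ zD) yX' e1 e2 (tpar _ zD).
    rewrite pp in e1 e2; split=> //.
      exact: (place_inj m1 (pm z') (topX z) yX e1).
    exact: (place_inj m1 (pm z') (parX _ zD) yX' e2).
  case=> -[e1 e2]; last first.
    (* The endpoints cannot be matched crosswise, since in both codes the corner has a shorter
       address than the top. *)
    have [_ e3 e4] := key _ _ (parX _ zD') (topX z') e1 e2.
    move: (top_lt _ zD) (top_lt _ zD'); rewrite e4 -e3 => h1 /(ltn_trans h1).
    by rewrite ltnn.
  have [pp e3 e4] := key _ _ (topX z') (parX _ zD') e1 e2.
  rewrite inE in zD; rewrite inE in zD'.
  have x12 : z.2.1 = z'.2.1.
    by move/eqP: e3; rewrite /top nth_uniq ?(uniq_link uU) // => /eqP/val_inj.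
  have c12 : z.2.2 = z'.2.2.
    have zD3 : z'.2.2 \in top z by rewrite e3.
    exact: (par_inj (w := top z) zD zD3 (etrans e4 (esym (congr1 (par z'.2.2) e3)))).
  move: pp x12 c12; case: (z) => [[j i] [x c]]; case: (z') => [[j' i'] [x' c']].
  by rewrite /pos /= => -[/val_inj-> /val_inj->] -> ->.
have cardE : #|E| = (3 * (k * m * (size U).+1))%N.
  rewrite (card_in_imset ends_inj).
  pose IT := [set xc : 'I_(size X) * letter | xc.2 \in nth [::] X xc.1]%SET.
  have -> : D = finset.setX [set: 'I_k * 'I_m]%SET IT by apply/setP => z; rewrite !inE.
  by rewrite cardsX cardsT card_prod !card_ord link_edges_card mulnCA.
rewrite -cardE; apply: (leq_bigmax_cond (F := fun E : {set {set 'I_n}} => #|E|)).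
apply/and3P; split.
- by apply/forall_inP => e /imsetP[z zD ->]; rewrite cards2 lab_neq.
- apply/asboolP; apply: (@planar_of_addresses _ _ _ nu) => // e /imsetP[z zD ->].
  have zD2 : z.2.2 \in top z by rewrite inE in zD.
  case/orP: (adj_place m1 (pm z) (topX z) zD2) => /childP[i iy yE].
    exists (lab (place m (pos z) (top z))), (lab (place m (pos z) (par z.2.2 (top z)))), i.
    by rewrite !labP // parX.
  exists (lab (place m (pos z) (par z.2.2 (top z)))), (lab (place m (pos z) (top z))), i.
  by rewrite {1}/ends finset.setUC !labP // parX.
- apply/asboolP => -[f f_inj fE].
  apply: (@necklace_cycle_free U m m1 l (nu \o f)) => //; first exact: inj_comp.
  move=> c; have : [set f c; f (ordS c)]%SET \in E.
    have <- : (f @: [set c; ordS c] = [set f c; f (ordS c)])%SET by rewrite imsetU1 imset_set1.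
    by apply: fE; apply/imsetP; exists c.
  move=> /imsetP[z zD /esym /(setP2 _ _ _ _ _ (lab_neq _ zD))[] [/= <- <-]]; rewrite !labP ?parX //.
    exists (pos z), (top z), (par z.2.2 (top z)); split; rewrite ?parX //.
    by rewrite inE in zD; rewrite adjC /adj child_par.
  exists (pos z), (par z.2.2 (top z)), (top z); split; rewrite ?parX //.
  by rewrite inE in zD; rewrite /adj child_par.
Qed.

(** * Links without long cycles *)

Fixpoint words (d : nat) : seq address :=
  if d is d'.+1 then [::] :: [seq i :: w | i <- [:: L0; L1; L2], w <- words d']
  else [:: [::]].

Lemma mem_words d u : (u \in words d) = (size u <= d).
Proof.
elim: d u => [|d IH] u; first by rewrite inE leqn0 size_eq0.
rewrite /words -/words in_cons; case: u => [|i u]; first by rewrite eqxx.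
rewrite orFb ltnS -IH.
apply/allpairsP/idP => [[[j w] [/= _ wd [_ ->]]] //|ud].
by exists (i, u); split=> //; case: (i) => [[]|].
Qed.

Lemma uniq_words d : uniq (words d).
Proof.
elim: d => // d IH; rewrite /words -/words cons_uniq allpairs_uniq ?andbT //.
  by apply/allpairsP => -[[j w] [_ _]].
by move=> [i u] [j v] _ _ [-> ->].
Qed.

Lemma par_closed_words d : par_closed (words d).
Proof. by move=> u i; rewrite !mem_words => ud /size_par/ltnW/leq_trans; apply. Qed.

Lemma size_words d : 3 ^ d <= size (words d).
Proof.
elim: d => // d IH; rewrite expnS /words -/words -cat1s size_cat size_allpairs.
by apply: leq_trans (leq_addl _ _); apply: (leq_mul (leqnn 3) IH).
Qed.

(** The addresses in the link have length at most [d.+3], so [path_depth_size] applies to the cycle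
    cut open. *)
Lemma link_free_words d l : 2 ^ d.+4 <= l -> link_free l (words d).
Proof.
move=> dl F F_inj Fin Fadj; pose s := [seq F c | c <- enum 'I_l].
have sz : size s = l by rewrite size_map size_enum_ord.
suff: size s < 2 ^ d.+4 by rewrite sz ltnNge dl.
apply: path_depth_size.
- apply/allP => x /mapP[c _ ->]; case/linkP: (Fin c) => [->|->|[w -> /leafP[->|[u -> ]]]] //=.
  by rewrite mem_words.
- by rewrite map_inj_uniq ?enum_uniq.
apply/(sortedP [::]) => i; rewrite sz => il; have il' := ltnW il.
have nthF j (jl : j < l) : nth [::] s j = F (Ordinal jl).
  rewrite (nth_map (Ordinal jl)) -?enumT ?size_enum_ord //.
  by congr (F _); apply: val_inj; rewrite /= nth_enum_ord.
rewrite (nthF i il') (nthF i.+1 il) (_ : Ordinal il = ordS (Ordinal il')) //.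
by apply: val_inj; rewrite /= modn_small.
Qed.

(* The link of [gh_core] has 10 vertices; adding [:: L2; L1] completes it to the
   Goldner-Harary graph, the smallest non-Hamiltonian triangulation, and the rest
   of the chain pads one component of the complement of [separator]. *)
Definition gh_core : seq address :=
  [:: [::]; [:: L2]; [:: L2; L0]; [:: L2; L2]; [:: L2; L0; L0]; [:: L2; L0; L1]; [:: L2; L0; L2]].

Definition gh (r : nat) : seq address :=
  gh_core ++ [seq [:: L2, L1 & nseq i L0] | i <- iota 0 r].

Lemma size_gh r : size (gh r) = 7 + r.
Proof. by rewrite size_cat size_map size_iota. Qed.

Lemma uniq_gh r : uniq (gh r).
Proof.
rewrite cat_uniq map_inj_uniq ?iota_uniq ?andbT => [|i j [/(congr1 size)]]; last first.
  by rewrite !size_nseq.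
by apply/hasPn => _ /mapP[i _ ->].
Qed.

Lemma par_closed_gh r : par_closed (gh r).
Proof.
move=> u i; rewrite mem_cat => /orP[]; last first.
  case/mapP => j; rewrite mem_iota => jr -> iu; rewrite mem_cat.
  case: (boolP (i \in nseq j L0)) => [ij|ij].
    apply/orP; right; move: ij; rewrite mem_nseq => /andP[j0 /eqP iE].
    case: j j0 jr {iu} => // j _ jr.
    rewrite iE -[in par _ _](addn1 j) nseqD -!cat_cons par_catl //= cats0.
    by apply: map_f; rewrite mem_iota; lia.
  rewrite (@par_catr i [:: L2; L1]) //.
  by move: iu; rewrite !inE (negbTE ij) orbF => /orP[] /eqP->.
have core : all (fun u => all (fun i => par i u \in gh_core) u) gh_core by [].
by move=> /(allP core)/allP h /h; rewrite mem_cat => ->.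
Qed.

Definition separator : seq address :=
  [:: [::]; [:: L0]; [:: L0; L1; L2]; [:: L0; L1; L2; L2]; [:: L0; L1; L2; L2; L0]].

(** Label 0 is the separator, 1 the padding chain, and 2 to 6 are isolated vertices; addresses
    outside the link get 7 or a label of no meaning. *)
Definition component (y : address) : nat :=
  if y \in separator then 0
  else if prefix [:: L0; L1; L2; L2; L1] y then 1
  else (index y [:: [:: L0; L1]; [:: L0; L1; L2; L2; L2]; [:: L0; L1; L2; L2; L0; L0];
                    [:: L0; L1; L2; L2; L0; L1]; [:: L0; L1; L2; L2; L0; L2]]).+2.

Lemma component0 y : component y = 0 -> y \in separator.
Proof. by rewrite /component; case: ifP => //; case: ifP. Qed.

Lemma component_chain x : component ([:: L0; L1; L2; L2; L1] ++ x) = 1.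
Proof.
rewrite /component; have -> : ([:: L0; L1; L2; L2; L1] ++ x \in separator) = false by [].
by rewrite prefix_prefix.
Qed.

Lemma gh_linkP r y : y \in link (gh r) ->
  y \in (link gh_core) \/
  exists i, y = [:: L0; L1; L2; L2; L1] ++ nseq i L0.
Proof.
case/linkP => [->|->|[w -> /leafP[->|[u ->]]]]; try by left.
rewrite mem_cat => /orP[uc|/mapP[i _ ->]]; last by right; exists i.
by left; apply: mem_link; rewrite in_cons; apply/orP; right; exact: map_f.
Qed.

Lemma gh_component_adj r y z : y \in link (gh r) -> z \in link (gh r) -> adj y z ->
  component y != 0 -> component z != 0 -> component y = component z.
Proof.
wlog: y z / child y z => [W|].
  move=> yX zX; rewrite /adj => /orP[] h *; first by apply: W => //; rewrite /adj h.
  by apply/esym/W => //; rewrite /adj h.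
move=> yz _ zX _ y0 z0; apply/eqP; move: yz zX y0 z0.
have core : all (fun z => all (fun y =>
    (component y != 0) ==> (component z != 0) ==> (component y == component z))
    [seq par i z | i <- z]) (link gh_core) by [].
move=> yz /gh_linkP[/(allP core)/allP/(_ y yz)/implyP h y0 /(implyP (h y0))//|[i zE]].
(* A corner of a chain face is a chain vertex or a corner of [[:: L0; L1; L2; L2; L1]], and these
   three lie in the separator. *)
move: yz; rewrite zE => /childP[c]; case: (boolP (c \in nseq i L0)) => ci.
  by rewrite par_catl // => _ ->; rewrite !component_chain.
rewrite par_catr // mem_cat (negbTE ci) orbF !inE.
by move=> h ->; case: c h {ci} => [[]|].
Qed.

(** The link has [10 + r] vertices, so the cycle would be Hamiltonian. It would leave each of the
    six components to a vertex of the separator, and these six vertices would be distinct among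
    five. *)
Lemma link_free_gh r : 0 < r -> link_free (10 + r) (gh r).
Proof.
move=> r0 F F_inj Fin Fadj; pose s := [seq F c | c <- enum 'I_(10 + r)].
have us : uniq s by rewrite map_inj_uniq ?enum_uniq.
have ss : {subset s <= link (gh r)} by move=> x /mapP[c _ ->].
have szs : size (link (gh r)) <= size s by rewrite size_link size_gh size_map size_enum_ord.
have [_ sE] := uniq_min_size us ss szs.
have onto y : y \in link (gh r) -> exists c, F c = y.
  by rewrite -sE => /mapP[c _ ->]; exists c.
have hit (k : 'I_6) : exists c, component (F c) = k.+1.
  have core y : y \in gh_core -> [:: L0, L1, L2 & y] \in link (gh r).
    by move=> yc; apply: mem_link; rewrite in_cons map_f ?orbT // mem_cat yc.
  have [c Fc] : exists c, F c = nth [::] [:: [:: L0; L1; L2; L2; L1]; [:: L0; L1];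
      [:: L0; L1; L2; L2; L2]; [:: L0; L1; L2; L2; L0; L0];
      [:: L0; L1; L2; L2; L0; L1]; [:: L0; L1; L2; L2; L0; L2]] k.
    apply: onto; case: k => [[|[|[|[|[|[|k]]]]]] //= _]; try exact: core.
    apply: mem_link; rewrite in_cons; apply/orP; right; apply: map_f.
    by rewrite mem_cat; apply/orP; right; apply/mapP; exists 0; rewrite // mem_iota.
  by exists c; rewrite Fc; case: k {Fc} => [[|[|[|[|[|[|k]]]]]] //=].
have /fin_all_exists[g hg] (k : 'I_6) :
    exists c, component (F c) = k.+1 /\ component (F (ordS c)) = 0.
  have [a ha] := hit k; have [b hb] : exists b, component (F b) != k.+1.
    have [b0 h0] := hit ord0; have [b1 h1] := hit ord_max.
    have [k0|k0] := eqVneq (component (F b0)) k.+1; last by exists b0.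
    by exists b1; rewrite h1 -k0 h0.
  have [c /eqP hc hc'] := cyclic_switch (p := fun c => component (F c) == k.+1) (introT eqP ha) hb.
  exists c; split=> //; apply/eqP/negPn/negP => nz; case/negP: hc'.
  by rewrite -(gh_component_adj (Fin c) (Fin _) (Fadj c) _ nz) hc.
have : size [seq F (ordS (g k)) | k <- enum 'I_6] <= size separator.
  apply: uniq_leq_size => [|_ /mapP[k _ ->]]; last by apply: component0; case: (hg k).
  rewrite map_inj_uniq ?enum_uniq // => k k' /F_inj /(can_inj (@ordSK _)) e.
  by apply/val_inj/eq_add_S; have [<- _] := hg k; have [<- _] := hg k'; rewrite e.
by rewrite size_map size_enum_ord.
Qed.

(** * Edge counts *)

Local Open Scope ring_scope.

(** Each path adds [N] vertices and yields a surplus of [a.+1 - m], at least 1; [k] such surpluses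
    pay for the at most [N.+1] vertices beyond [k * N]. *)
Lemma necklace_arith (a m N k n : nat) :
  (m <= a)%N -> N.+1 = (m * a.+1)%N -> (a.+1 * N.+1 <= k)%N -> (n <= k * N + N.+1)%N ->
  (a.+1 * n <= a.+2 * (k * m * a))%N.
Proof.
move=> ma NE hk hn.
have step : (a.+2 * (m * a) = a.+1 * N + (a.+1 - m))%N.
  have : (a.+2 * (m * a) + m = a.+1 * N.+1)%N by rewrite NE; ring.
  by rewrite mulnS; lia.
rewrite -mulnA mulnCA step.
apply: (@leq_trans (a.+1 * (k * N) + a.+1 * N.+1)%N); first by rewrite -mulnDr leq_mul2l hn orbT.
rewrite mulnDr mulnCA leq_add2l; apply: leq_trans hk _.
by rewrite leq_pmulr // subn_gt0 ltnS.
Qed.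

Lemma ex_planar_cycle_gt (R : realType) (l n : nat) : (11 <= l)%N ->
  (l.-1 * (l./2.+1 * l.-1) * (l./2.+1 * l.-1) + 2 <= n)%N ->
  (3 * l.-1 * n < l * ex_planar R n (cycle_graph l) + 6 * l.+1)%N.
Proof.
move=> l11; pose m := l./2.+1; pose N := (m * l.-1).-1; rewrite -/m => hn.
have lE : l = (10 + (l - 10))%N by rewrite subnKC // ltnW.
have half := odd_double_half l.
have lm : (l < 2 * m)%N by rewrite /m; move: half; clear; lia.
have ml : (m <= l.-2)%N by rewrite /m; move: half l11; clear; lia.
have free : link_free l (gh (l - 10)) by rewrite {1}lE; apply: link_free_gh; rewrite subn_gt0.
have NS : N.+1 = (m * l.-1)%N by rewrite /N prednK // muln_gt0 /=; move: l11; clear; lia.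
have N0 : (0 < N)%N.
  by rewrite -ltnS NS; apply: (@leq_trans (1 * l.-1)%N);
    [move: l11; clear; lia | rewrite leq_mul2r orbT].
(* As many paths as fit into [n] vertices besides the two hubs. *)
pose k := ((n - 2) %/ N)%N.
have n2 : (2 <= n)%N by apply: leq_trans hn; rewrite leq_addl.
have kN : (k * N + 2 <= n)%N by rewrite -(subnK n2) leq_add2r leq_trunc_div.
have nk : (n <= k * N + N.+1)%N.
  by have := ltn_ceil (n - 2) N0; rewrite -/k mulSn; move: n2; clear; lia.
have hk : (l.-1 * N.+1 <= k)%N.
  rewrite leq_divRL //; apply: (@leq_trans (l.-1 * N.+1 * N.+1)%N).
    by rewrite leq_mul2l leqnSn orbT.
  by rewrite NS -(leq_add2r 2) subnK.
have sz : size (gh (l - 10)) = l.-2.-1 by rewrite size_gh; move: l11; clear; lia.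
have m1 : (1 < m)%N by rewrite /m; move: half l11; clear; lia.
have l2 : l = l.-2.+2 by move: l11; clear; lia.
have hE : (3 * (k * m * l.-2) <= ex_planar R n (cycle_graph l))%N.
  have -> : l.-2 = (size (gh (l - 10))).+1 by rewrite sz; move: l11; clear; lia.
  apply: ex_planar_ge => //; [exact: uniq_gh | exact: par_closed_gh |].
  by rewrite sz (_ : l.-2.-1.+2 = l.-1) ?subn1 //; move: l11; clear; lia.
have := @necklace_arith l.-2 m N k n ml; rewrite -!l2 (_ : l.-2.+1 = l.-1); last first.
  by move: l11; clear; lia.
move=> /(_ NS hk nk) le1.
(* The necklace already attains [3 * l.-1 * n]; the additive term makes the inequality strict. *)
apply: (@leq_ltn_trans (l * ex_planar R n (cycle_graph l))%N); last by rewrite -addn1 leq_add2l.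
rewrite -mulnA; apply: (@leq_trans (l * (3 * (k * m * l.-2)))%N).
  by rewrite [leqRHS]mulnCA leq_mul2l le1 orbT.
by rewrite leq_mul2l hE orbT.
Qed.

(** With [n] the number of vertices, the inequality reduces to [n <= s * (k * (m - 1) + 2)]. As
    [2 <= k] and [s <= t], the right side is at most [k * m * t], which is less than [n]. *)
Lemma dense_arith (s k m t : nat) : (1 < k)%N -> (0 < m)%N -> (s <= t)%N ->
  ~~ (s * (k * m * t) + (k * (m * t + m.-1) + 2) <= s * (k * (m * t + m.-1) + 2))%N.
Proof.
case: m => // m k1 _ st.
have : (s * (k * m) + 2 * s <= k * (m.+1 * t))%N.
  apply: (@leq_trans (k * (m.+1 * s))%N); last by rewrite !leq_mul2l st !orbT.
  have -> : (k * (m.+1 * s) = s * (k * m) + k * s)%N by ring.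
  by rewrite leq_add2l leq_mul2r k1 orbT.
rewrite -(mulnA k) /=; move: (m.+1 * t)%N => q; rewrite -ltnNge !mulnDr; lia.
Qed.

Lemma sparsity_ge (R : realType) (l d s : nat) : (2 ^ d.+4 <= l)%N -> (0 < s)%N ->
  (exists N' : nat, forall n : nat, (N' <= n)%N ->
     (ex_planar R n (cycle_graph l))%:R <= 3 * (s%:R - 1) / s%:R * n%:R :> R) ->
  (3 ^ d <= s)%N.
Proof.
move=> dl s0 [N' bound]; rewrite leqNgt; apply/negP => sd.
(* [m] is least with [l < 2 * m], [t] is one less than the order of a link, and [k] ensures both
   [N' <= n] and the two paths that [dense_arith] requires. *)
pose m := l./2.+1; pose t := (size (words d)).+2; pose k := N'.+2.
have half := odd_double_half l.
have lm : (l < 2 * m)%N by rewrite /m; move: half; clear; lia.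
have l2 : (1 < l)%N by apply: leq_trans dl; apply: (@leq_pexp2l 2 1).
have m1 : (1 < m)%N by rewrite /m; move: half l2; clear; lia.
have st : (s.+2 < t)%N by rewrite !ltnS; apply: leq_trans (size_words d).
pose n := (k * (m * t - 1) + 2)%N.
have hE : (3 * (k * m * t.-1) <= ex_planar R n (cycle_graph l))%N.
  by apply: ex_planar_ge => //; [exact: uniq_words | exact: par_closed_words
    | exact: link_free_words].
have mt : (1 < m * t)%N by apply: (@leq_mul 2 1).
have N'n : (N' <= n)%N.
  rewrite /n; apply: leq_trans (leq_addr _ _); apply: leq_trans (leqW (leqnSn _)) _.
  by rewrite leq_pmulr // subn_gt0.
have le1 : (s * (k * m * t.-1) + n <= s * n)%N.
  have s0R : (0 : R) < s%:R by rewrite ltr0n.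
  have : (s%:R * (3 * (k * m * t.-1))%:R <= 3 * (s%:R - 1) * n%:R :> R).
    have := le_trans (_ : (3 * (k * m * t.-1))%:R <= _ :> R) (bound n N'n).
    rewrite ler_nat => /(_ hE) h; rewrite -(ler_pM2l s0R) in h; apply: le_trans h _.
    by rewrite le_eqVlt; apply/orP; left; apply/eqP; field; rewrite gt_eqF.
  rewrite -(ler_nat R) natrD !natrM; lra.
have nE : n = (k * (m * t.-1 + m.-1) + 2)%N.
  by rewrite /n /t /= mulnS [(m + _)%N]addnC -addnBA // subn1.
by move: le1; rewrite nE; apply/negP/dense_arith => //; rewrite -ltnS ltnW // ltnW.
Qed.

Lemma powR_log_le (R : realType) (l d : nat) : (l <= 2 ^ d)%N ->
  l%:R `^ (ln 3 / ln 2) <= (3 ^ d)%:R :> R.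
Proof.
move=> ld; have ln2 : 0 < ln 2 :> R by rewrite ln_gt0 // ltr1n.
have ln3 : 0 < ln 3 :> R by rewrite ln_gt0 // ltr1n.
apply: (@le_trans _ _ ((2 ^ d)%:R `^ (ln 3 / ln 2))).
  by apply: ge0_ler_powR; rewrite ?nnegrE ?ler0n ?ler_nat // divr_ge0 // ltW.
rewrite !natrX /powR expf_eq0 pnatr_eq0 andbF lnXn ?ltr0n // mulrnAr.
by rewrite divfK ?gt_eqF // -lnXn ?ltr0n // lnK // posrE exprn_gt0 // ltr0n.
Qed.

Theorem theorem1 (R : realType) :
  (forall l : nat, (11 <= l)%N ->
     exists N : nat, forall n : nat, (N <= n)%N ->
       (ex_planar R n (cycle_graph l))%:R >
         3 * (l%:R - 1) / l%:R * n%:R - 6 * (l%:R + 1) / l%:R :> R)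
  /\
  (forall s : nat -> nat,
     (forall l : nat, (0 < l)%N -> (0 < s l)%N) ->
     (forall l : nat, (3 <= l)%N ->
        exists N' : nat, forall n : nat, (N' <= n)%N ->
          (ex_planar R n (cycle_graph l))%:R <=
            3 * ((s l)%:R - 1) / (s l)%:R * n%:R :> R) ->
     exists c : R, 0 < c /\
       exists l0 : nat, forall l : nat, (l0 <= l)%N ->
         c * (l%:R `^ (ln 3 / ln 2)) <= (s l)%:R).
Proof.
split=> [l l11|s s_gt0 bound].
  exists (l.-1 * (l./2.+1 * l.-1) * (l./2.+1 * l.-1) + 2)%N => n /(ex_planar_cycle_gt R l11).
  case: l l11 => // l _; set e := ex_planar _ _ _.
  rewrite -(ltr_nat R) !natrD !natrM /= => h.
  have l0 : 0 < l.+1%:R :> R by rewrite ltr0n.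
  rewrite mulrAC -mulrBl ltr_pdivrMr // ltrBlDr [_ * l.+1%:R]mulrC.
  by move: h; rewrite -(natr1 l) -(natr1 l.+1) -(natr1 l) addrK; lra.
(* With [d + 4] the integer part of the binary logarithm of [l], one has [l < 2 ^ (d + 5)], which
   costs the factor [3 ^ 5] against [3 ^ d]. From 16 on, the subtraction of 4 is not truncated. *)
exists (3 ^+ 5)^-1; split; first by rewrite invr_gt0 exprn_gt0.
exists 16%N => l l16; have l_gt0 : (0 < l)%N by apply: leq_trans l16.
pose d := (trunc_log 2 l - 4)%N.
have d4 : (d.+4 = trunc_log 2 l)%N.
  by rewrite -addn4 subnK // trunc_log_max.
have sd : (3 ^ d <= s l)%N.
  apply: (@sparsity_ge R l) (s_gt0 _ l_gt0) (bound l (leq_trans _ l16)) => //.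
  by rewrite d4; apply: trunc_logP.
apply: (@le_trans _ _ (3 ^ d)%:R); last by rewrite ler_nat.
rewrite ler_pdivrMl ?exprn_gt0 ?ltr0n //; apply: le_trans (@powR_log_le R l (5 + d) _) _.
  by rewrite [(5 + d)%N](_ : _ = d.+4.+1) // d4; apply/ltnW/trunc_log_ltn.
by rewrite expnD natrM natrX.
Qed.
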